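(* Let $\mathbf{u}=(u_n)_{n\in\mathbb{N}}$ and $\mathbf{v}=(v_n)_{n\in\mathbb{N}}$ be sequences in $\{0,1\}^{\mathbb{N}}$. Let $\tilde f(0)=\tilde f(1)=1$, $\tilde f(2)=a+b$ and $$\tilde f(n)=a\tilde f(n-1-u_n)+b\tilde f(n-2-v_n)\qquad (n\ge 3),$$ where $a,b$ are either fixed integers such that $\tilde f(n)\ne 0$ for all $n\in\mathbb{N}$, or independent indeterminates over $\mathbb{Q}$. Put $\tilde h(n)=\tilde f(n+1)/\tilde f(n)$ and $\mathcal{V}(\tilde f)=\{\tilde h(n):n\in\mathbb{N}\}$. Consider the set \begin{align*} \tilde{\mathcal{R}}&=\{n\in\mathbb{N}: (u_n,u_{n+1})\in\{(0,1),(1,0)\}\text{ and }(v_n,v_{n+1},v_{n+2})=(0,1,0)\}\cup\{0\}\\ &=\{n_0=0<n_1<\cdots\}. \end{align*} If $\tilde{\mathcal{R}}$ has gaps bounded by $c$, then $\#\mathcal{V}(\tilde f)\le 4^{c-1}+1$. Moreover, if $\tilde{\mathcal{R}}$ has gaps bounded by $c$ and the sequences $\mathbf{u},\mathbf{v}$ are additionally $k$-automatic, then $(\tilde h(n))_{n\in\mathbb{N}}$ is also $k$-automatic.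
   Context: $\mathbb{N}=\{0,1,2,\ldots\}$. A set $\{n_0=0<n_1<\cdots\}\subset\mathbb{N}$ is said to have gaps bounded by $c$ (where $c\ge 1$ is an integer) if it is infinite and $n_{j+1}-n_j\le c$ for all $j\in\mathbb{N}$. For an integer $k\ge 2$, a sequence $(x_n)_{n\in\mathbb{N}}$ with values in some set is called $k$-automatic if it is generated by a deterministic finite automaton with output reading the base-$k$ representation of $n$; equivalently, if its $k$-kernel $\{(x_{k^jn+i})_{n\in\mathbb{N}}: j\in\mathbb{N},\ 0\le i<k^j\}$ is a finite set and the sequence takes finitely many values. *)

(* Defs.v *)
From mathcomp Require Import all_boot all_order all_algebra.
From mathcomp Require Export boolp classical_sets functions cardinality.
From mathcomp Require Export mpoly.

Set Implicit Arguments.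
Unset Strict Implicit.
Unset Printing Implicit Defensive.

Import GRing.Theory.
Local Open Scope classical_set_scope.
Local Open Scope ring_scope.

(* Deterministic finite automata with output over the digits 0, ..., k - 1. *)
Record dfao (k : nat) (T : Type) := Dfao {
  state : finType;
  init : state;
  trans : state -> 'I_k -> state;
  out : state -> T
}.

Definition run (k : nat) (T : Type) (M : dfao k T) (w : seq 'I_k) : T :=
  out (foldl (@trans k T M) (init M) w).

(* Most significant digit first, without leading zeros; the representation
   of 0 is the empty word. *)
Definition base_repr (k : nat) (w : seq 'I_k) (n : nat) : Prop :=
  (if w is d :: _ then (0 < d)%N else true) /\
  foldl (fun m (d : 'I_k) => (m * k + d)%N) 0%N w = n.

Definition automatic (k : nat) (T : Type) (x : nat -> T) : Prop :=
  exists M : dfao k T,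
    forall (w : seq 'I_k) (n : nat), base_repr w n -> x n = run M w.

(* [s] is the increasing enumeration n_0 = 0 < n_1 < ... of the set [A]. *)
Definition gaps_bounded_by (c : nat) (A : set nat) : Prop :=
  exists s : nat -> nat,
    [/\ s 0%N = 0%N,
        {homo s : i j / (i < j)%N},
        A = range s &
        forall j, (s j.+1 - s j <= c)%N].

(* The booleans u n and v n are coerced to the naturals 0 and 1.  No
   subtraction of naturals truncates here, since 3 <= n. *)
Definition satisfies_recurrence (F : fieldType) (u v : nat -> bool) (a b : F)
    (f : nat -> F) : Prop :=
  [/\ f 0%N = 1, f 1%N = 1, f 2%N = a + b &
      forall n, (3 <= n)%N ->
        f n = a * f (n - 1 - u n)%N + b * f (n - 2 - v n)%N].

Definition succ_ratio (F : fieldType) (f : nat -> F) (n : nat) : F :=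
  f n.+1 / f n.

Definition reset_set (u v : nat -> bool) : set nat :=
  [set n | ((u n, u n.+1) = (false, true) \/ (u n, u n.+1) = (true, false)) /\
           (v n, v n.+1, v n.+2) = (false, true, false)] `|` [set 0%N].

(* The field Q(X_0, X_1). *)
Definition ratfun2 : fieldType := {fraction {mpoly rat[2]}}.

Definition indet (i : 'I_2) : ratfun2 := tofrac ('X_i : {mpoly rat[2]}).

(* Main.v *)
Require Import Defs.
From mathcomp Require Import all_boot all_order all_algebra.
From mathcomp Require Import boolp classical_sets functions cardinality.
From mathcomp Require Import zify ring.

Set Implicit Arguments.
Unset Strict Implicit.
Unset Printing Implicit Defensive.

Import Order.TTheory GRing.Theory Num.Theory.
Local Open Scope classical_set_scope.
Local Open Scope ring_scope.

(** The recurrence reads one letter [(u n, v n)] at a time and remembers three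
consecutive terms of [f], so the ratios of these terms evolve by a fixed map
[step] driven by the letters.  At a reset [p] the memory is lost: the conditions
on [u p, u p.+1] and [v p, v p.+1, v p.+2] make [f p], [f p.+1] and [f p.+2]
multiples of one common earlier term, with factors depending only on [u p] and,
if [u p] holds, on [u p.+2] ([reset_forgets_past]).  The start
[f 0 = f 1 = 1, f 2 = a + b] looks like a reset with [u p = false].  Hence
[f n.+1 / f n] depends only on the type of the last reset [p <= n] and on the
letters read since then.

Bound.  There are 2 possible values at a reset.  One place later there are 3
possible states, and each further letter multiplies their number by 4.  As the
last reset is at distance less than [c], at most
[2 + 3 * (1 + 4 + ... + 4 ^ (c - 2)) = 4 ^ (c - 1) + 1] values occur
([size_values], [succ_ratio_in_values]).  One point needs care: if 1 belongs to
the reset set, the recurrence does not yet hold there and 1 does not act as a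
reset.  Counting from 0 instead, the only index left out is [n = c], and its
value is absorbed by a coincidence in the list ([values_not_uniq]).

Automaticity.  For [n > c] the ratio is a function of a window of bounded length
of [(u, v)] around [n] ([succ_ratio_window]).  Windows of automatic sequences,
sequences factoring through an automatic one, and sequences with an automatic
tail are automatic.

With indeterminate coefficients, [f n] is a polynomial that is positive at
[(1, 1)], so no term vanishes and the same argument applies
([indet_recurrence_neq0]). *)

(** * Automatic sequences *)

(** Base-[k] digits, most significant first and none for 0; [fuel >= n] is
enough. *)
Fixpoint digits (k : nat) (k_gt0 : (0 < k)%N) (fuel n : nat) : seq 'I_k :=
  if fuel is fuel'.+1 then
    if n == 0%N then [::]
    else rcons (digits k_gt0 fuel' (n %/ k)) (Ordinal (ltn_pmod n k_gt0))
  else [::].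

Lemma digits_fuel (k : nat) (k_gt0 : (0 < k)%N) (fuel n : nat) :
  (1 < k)%N -> (n <= fuel)%N -> digits k_gt0 fuel n = digits k_gt0 n n.
Proof.
move=> k_gt1; elim/ltn_ind: fuel n => -[|fuel] IH [|n] //= le_n.
by rewrite IH ?(IH n) //; have := ltn_Pdiv k_gt1 (ltn0Sn n); lia.
Qed.

Lemma digits_rcons (k : nat) (k_gt0 : (0 < k)%N) (m : nat) (d : 'I_k) :
  (1 < k)%N -> let n := (m * k + d)%N in
  (0 < n)%N -> digits k_gt0 n n = rcons (digits k_gt0 m m) d.
Proof.
move=> k_gt1 n n_gt0.
have nk : (n %/ k)%N = m by rewrite divnMDl // divn_small ?addn0.
case En : n n_gt0 => [|n'] //= _; rewrite -En nk.
have ltmn : (m < n)%N.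
  by rewrite -nk; apply: ltn_Pdiv => //; rewrite En.
congr rcons; first by apply: digits_fuel => //; lia.
by apply: val_inj; rewrite /= /n modnMDl modn_small.
Qed.

Lemma digits_repr (k : nat) (k_gt0 : (0 < k)%N) (n : nat) :
  (1 < k)%N -> base_repr (digits k_gt0 n n) n.
Proof.
move=> k_gt1; elim/ltn_ind: n => -[//|n] IH.
set N := n.+1.
have EN : N = (N %/ k * k + Ordinal (ltn_pmod N k_gt0))%N by exact: divn_eq.
have ltN : (N %/ k < N)%N by exact: ltn_Pdiv.
rewrite {1 2}EN digits_rcons -?EN //.
have [] := IH _ ltN; case Ed : (digits _ _ _) => [|x w] /= lead val.
  by split => //=; rewrite -?val ?add0n //; move: EN; rewrite -val /N /=; lia.
by split => //=; rewrite foldl_rcons val -EN.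
Qed.

(** The state may be indexed by the number read instead of by the word; this is
insensitive to leading zeros and lets one compute with [m * k + d]. *)
Lemma automaticP (k : nat) (T : Type) (x : nat -> T) : (1 < k)%N ->
  automatic k x <->
  exists (S : finType) (q : nat -> S) (delta : S -> 'I_k -> S) (o : S -> T),
    (forall m (d : 'I_k), q (m * k + d)%N = delta (q m) d) /\
    (forall n, x n = o (q n)).
Proof.
move=> k_gt1; have k_gt0 : (0 < k)%N by lia.
split=> [[M HM]|[S [q [delta [o [Hq Hx]]]]]].
  (* The boolean records that only zeros were read: digits 0 is empty. *)
  exists (bool * state M : finType)%type,
    (fun n => (n == 0%N, foldl (@trans _ _ M) (init M) (digits k_gt0 n n))),
    (fun s (d : 'I_k) =>
       if s.1 && (d == 0%N :> nat) then s else (false, trans s.2 d)),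
    (fun s => out s.2); split=> [m d|n] /=.
    case: ifP => [/andP[/eqP-> /eqP->]|nz]; first by rewrite mul0n.
    have n_gt0 : (0 < m * k + d)%N.
      rewrite lt0n addn_eq0 muln_eq0 (_ : (k == 0)%N = false) ?orbF ?nz //.
      by lia.
    by rewrite digits_rcons // foldl_rcons eqn0Ngt n_gt0.
  by rewrite (HM _ _ (digits_repr k_gt0 n k_gt1)).
exists (Dfao (q 0%N) delta o) => w n [_ <-]; rewrite Hx /run /=; congr o.
by elim: w (0%N) => //= d w IH m; rewrite IH Hq.
Qed.

(** A sequence that factors through an automatic one is automatic, because the
output map may be chosen state by state. *)
Lemma automatic_factor (k : nat) (T U : Type) (x : nat -> T) (y : nat -> U) :
  (1 < k)%N -> (forall m n, x m = x n -> y m = y n) ->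
  automatic k x -> automatic k y.
Proof.
move=> k_gt1 xy /automaticP-/(_ k_gt1)[S [q [delta [o [Hq Hx]]]]].
apply/automaticP => //; exists S, q, delta.
exists (fun s => y (xget 0%N [set n | q n = s])); split=> [//|n].
by apply: xy; rewrite !Hx; case: xgetP => [m _ /= ->|/(_ n)[]].
Qed.

Lemma automatic_pair (k : nat) (T U : Type) (x : nat -> T) (y : nat -> U) :
  (1 < k)%N -> automatic k x -> automatic k y ->
  automatic k (fun n => (x n, y n)).
Proof.
move=> k_gt1 /automaticP-/(_ k_gt1)[S [q [delta [o [Hq Hx]]]]].
move=> /automaticP-/(_ k_gt1)[S' [q' [delta' [o' [Hq' Hx']]]]].
apply/automaticP => //; exists (S * S' : finType)%type, (fun n => (q n, q' n)).
exists (fun s d => (delta s.1 d, delta' s.2 d)), (fun s => (o s.1, o' s.2)).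
by split=> [m d|n]; rewrite ?Hq ?Hq' ?Hx ?Hx'.
Qed.

(** Tracking the states of [n] and [n.+1] together is enough, since adding 1 to
[m * k + d] either changes the last digit only, or gives [m.+1 * k]. *)
Lemma automatic_succ (k : nat) (T : Type) (x : nat -> T) :
  (1 < k)%N -> automatic k x -> automatic k (fun n => x n.+1).
Proof.
move=> k_gt1 /automaticP-/(_ k_gt1)[S [q [delta [o [Hq Hx]]]]].
have k_gt0 : (0 < k)%N by lia.
apply/automaticP => //; exists (S * S : finType)%type, (fun n => (q n, q n.+1)).
exists (fun s (d : 'I_k) => (delta s.1 d,
  if insub d.+1 is Some d' then delta s.1 d' else delta s.2 (Ordinal k_gt0))).
exists (fun s => o s.2); split=> [m d|n] //=; rewrite Hq -addnS; congr pair.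
case: insubP => [d' _ <-|]; first exact: Hq.
by rewrite -Hq /= => le_k; congr q; have := ltn_ord d; lia.
Qed.

(** Dually to [automatic_succ], subtracting 1 borrows from the last digit or
from the prefix; the boolean detects zero, where a value can be prepended. *)
Lemma automatic_of_succ (k : nat) (T : Type) (x : nat -> T) :
  (1 < k)%N -> automatic k (fun n => x n.+1) -> automatic k x.
Proof.
move=> k_gt1 /automaticP-/(_ k_gt1)[S [q [delta [o [Hq Hx]]]]].
have k_gt0 : (0 < k)%N by lia.
have k1_lt : (k.-1 < k)%N by lia.
apply/automaticP => //; exists (bool * (S * S) : finType)%type.
exists (fun n => (n == 0%N, (q n, q n.-1))).
exists (fun s (d : 'I_k) => (s.1 && (d == 0%N :> nat), (delta s.2.1 d,
  if d == 0%N :> nat then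
    if s.1 then s.2.1 else delta s.2.2 (Ordinal k1_lt)
  else delta s.2.1 (insubd d d.-1)))).
exists (fun s => if s.1 then x 0%N else o s.2.2); split=> [m d|[|n]] //=.
rewrite Hq; congr (_, (_, _)).
  by rewrite addn_eq0 muln_eq0 (_ : (k == 0)%N = false) ?orbF //; lia.
case: (eqVneq (d : nat) 0%N) => [->|d_neq0].
  case: m => [|m]; first by rewrite mul0n.
  by rewrite /= -Hq /=; congr q; lia.
by rewrite -Hq val_insubd; have := ltn_ord d; case: ifP => ? ?; congr q; lia.
Qed.

Lemma automatic_of_shift (k : nat) (T : Type) (x : nat -> T) (N : nat) :
  (1 < k)%N -> automatic k (fun n => x (n + N)%N) -> automatic k x.
Proof.
move=> k_gt1; elim: N x => [|N IH] x.
  by rewrite (_ : (fun n => _) = x) // funeqE => n; rewrite addn0.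
move=> Hx; apply: IH; apply: automatic_of_succ => //.
rewrite (_ : (fun n => _) = (fun n => x (n + N.+1)%N)) // funeqE => n.
by rewrite addSnnS.
Qed.

Lemma automatic_shift (k : nat) (T : Type) (x : nat -> T) (N : nat) :
  (1 < k)%N -> automatic k x -> automatic k (fun n => x (n + N)%N).
Proof.
move=> k_gt1; elim: N x => [|N IH] x Hx.
  by rewrite (_ : (fun n => _) = x) // funeqE => n; rewrite addn0.
rewrite (_ : (fun n => _) = (fun n => x (n + N).+1)).
  exact: (IH (fun n => x n.+1) (automatic_succ k_gt1 Hx)).
by rewrite funeqE => n; rewrite addnS.
Qed.

Lemma automatic_window (k : nat) (T : Type) (x : nat -> T) (K : nat) :
  (1 < k)%N -> automatic k x ->
  automatic k (fun n => mkseq (fun i => x (n + i)%N) K).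
Proof.
move=> k_gt1 Hx; elim: K => [|K IH]; first exact: (automatic_factor k_gt1 _ Hx).
have Hw := automatic_pair k_gt1 IH (automatic_shift K k_gt1 Hx).
by apply: (automatic_factor k_gt1 _ Hw) => m n [E0 E]; rewrite !mkseqS E0 E.
Qed.

(** * Consecutive ratios as a finite-letter dynamical system *)

Section Ratios.

Variables (F : fieldType) (a b : F).

(** The ratio pair [(f m / f m.+1, f m.-1 / f m.+1)] from the previous such
pair and the letter [(u m.+1, v m.+1)]. *)
Definition step (s : F * F) (l : bool * bool) : F * F :=
  let t := a * (if l.1 then s.1 else 1) + b * (if l.2 then s.2 else s.1) in
  (t^-1, s.1 / t).

(** The value of [f p.+1 / f p] at a reset [p] with [up = u p]. *)
Definition reset_value (up : bool) : F := if up then a + b / (a + b) else 1.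

(** The ratio pair two places after a reset at [p], from [up = u p] and
[up2 = u p.+2]: up to a common factor, the terms from [p] on are [1, 1, a + b]
if [up = false], and [a + b, e, t] otherwise. *)
Definition reset_state (up up2 : bool) : F * F :=
  if up then
    let e := a * (a + b) + b in
    let t := a * (if up2 then a + b else e) + b * (a + b) in
    (e / t, (a + b) / t)
  else ((a + b)^-1, (a + b)^-1).

Definition letters : seq (bool * bool) :=
  [:: (false, false); (false, true); (true, false); (true, true)].

(** The ratio pairs that can occur [j.+2] places after a reset; there are three
initial ones because [u p.+2] matters only if [u p] holds. *)
Fixpoint states (j : nat) : seq (F * F) :=
  if j is i.+1 then [seq step s l | s <- states i, l <- letters]
  else [:: reset_state false false; reset_state true false;
           reset_state true true].

(** Values at positive distance at most [j] from a reset. *)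
Fixpoint later_values (j : nat) : seq F :=
  if j is i.+1 then later_values i ++ [seq s.1^-1 | s <- states i] else [::].

Definition values (c : nat) : seq F :=
  [:: reset_value false, reset_value true & later_values c.-1].

Lemma size_values (c : nat) : size (values c) = (4 ^ c.-1 + 1)%N.
Proof.
have size_states j : size (states j) = (3 * 4 ^ j)%N.
  elim: j => [//|j IH].
  by rewrite (size_allpairs step (states j) letters) IH /= expnS; lia.
rewrite /=; elim: c.-1 => //= j IH.
by rewrite size_cat size_map size_states expnS; lia.
Qed.

Lemma mem_later_values (i j : nat) (s : F * F) :
  (i < j)%N -> s \in states i -> s.1^-1 \in later_values j.
Proof.
move=> lt_ij s_in; elim: j lt_ij => //= j IH.
rewrite ltnS leq_eqVlt mem_cat => /predU1P[<-|/IH->//].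
by rewrite (map_f (fun s => s.1^-1) s_in) orbT.
Qed.

Variables (u v : nat -> bool) (f : nat -> F).
Hypotheses (rec_f : satisfies_recurrence u v a b f).
Hypotheses (f_neq0 : forall n, f n != 0).

Let recE (m : nat) : f m.+3 = a * f (m.+2 - u m.+3)%N + b * f (m.+1 - v m.+3)%N.
Proof.
have [_ _ _ /(_ m.+3 isT)->] := rec_f.
by rewrite !subSS !subn0.
Qed.

Let ab_neq0 : a + b != 0.
Proof. by have [_ _ <- _] := rec_f. Qed.

Definition ratios (m : nat) : F * F := (f m.-1 / f m, f m.-2 / f m).

Lemma ratios_step (m : nat) :
  ratios m.+3 = step (ratios m.+2) (u m.+3, v m.+3).
Proof.
rewrite /ratios /step /=.
set t := a * _ + _; have -> : t = f m.+3 / f m.+2.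
  rewrite /t recE.
  have := f_neq0 m.+2.
  by case: (u _); case: (v _) => ?; rewrite ?subn1 ?subn0 //=; field.
have := f_neq0 m.+2; have := f_neq0 m.+3.
by move=> n3 n2; congr pair; field; rewrite n3 n2.
Qed.

Lemma succ_ratioE (m : nat) : succ_ratio f m = (ratios m.+1).1^-1.
Proof. by rewrite /succ_ratio /= invf_div. Qed.

(** If [u p.+2 = false], the recurrence gives the same value
[a * f p.+1 + b * f p] for [f p.+2] and [f p.+3]; if [u p.+2 = true], it gives
[(a + b) * f p] and [a * f p.+2 + b * f p].  As [v p.+4 = false], [f p.+4] is
computed from these two terms, so the past enters only through one common
factor. *)
Lemma reset_forgets_past (p : nat) : reset_set u v p.+2 ->
  succ_ratio f p.+2 = reset_value (u p.+2) /\
  ratios p.+4 = reset_state (u p.+2) (u p.+4).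
Proof.
move=> [[Hu [v0 v1 v2]]|//].
have f2 : f p.+2 = a * f (p.+1 - u p.+2)%N + b * f p.
  case: p v0 {Hu v1 v2} => [|p] v0; last by rewrite recE v0 subn0.
  have [f0 f1 -> _] := rec_f.
  by case: (u 2); rewrite ?subn1 ?subn0 /= ?f0 ?f1 !mulr1.
have f3 := recE p; have f4 := recE p.+1.
rewrite v1 subn1 /= in f3; rewrite v2 subn0 in f4.
have n0 := f_neq0 p; have n2 := f_neq0 p.+2; have n4 := f_neq0 p.+4.
rewrite /succ_ratio /reset_value /reset_state /ratios /=.
case: Hu => -[u0 u1]; rewrite u0 u1 ?subn0 ?subn1 /= in f2 f3 *.
  have f32 : f p.+3 = f p.+2 by rewrite f2 f3.
  have f42 : f p.+4 = (a + b) * f p.+2.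
    by rewrite f4; case: (u _); rewrite ?subn1 ?subn0 /= ?f32; ring.
  by rewrite f32 f42; split; [|congr pair]; field; rewrite ?n2 ?ab_neq0.
have f20 : f p.+2 = (a + b) * f p by rewrite f2; ring.
have f30 : f p.+3 = (a * (a + b) + b) * f p by rewrite f3 f20; ring.
set t := a * (if _ then _ else _) + _; have f40 : f p.+4 = t * f p.
  by rewrite f4 /t; case: (u _); rewrite ?subn1 ?subn0 /= ?f30 ?f20; ring.
have t_neq0 : t != 0 by move: n4; rewrite f40 mulf_eq0 negb_or => /andP[].
by rewrite f40 f30 f20; split; [|congr pair]; field;
  rewrite ?n0 ?ab_neq0 ?t_neq0.
Qed.

Lemma ratios2 : ratios 2 = reset_state false false.
Proof. by have [f0 f1 f2 _] := rec_f; rewrite /ratios /= f0 f1 f2 div1r. Qed.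

Lemma succ_ratio0 : succ_ratio f 0%N = reset_value false.
Proof. by have [f0 f1 _ _] := rec_f; rewrite /succ_ratio f0 f1 divr1. Qed.

Lemma ratios_in_states (p j : nat) :
  reset_set u v p -> p != 1%N -> ratios (p.+2 + j)%N \in states j.
Proof.
move=> Rp p_neq1; elim: j => [|j IH].
  rewrite addn0; case: p Rp p_neq1 => [|[//|p]] Rp _.
    by rewrite ratios2 inE eqxx.
  have [_ ->] := reset_forgets_past Rp.
  by case: (u p.+2); case: (u p.+4); rewrite !inE eqxx ?orbT.
rewrite !addnS !addSn ratios_step; apply: allpairs_f; first by rewrite -!addSn.
by case: (u _); case: (v _).
Qed.

Lemma succ_ratio_in_values (c p n : nat) :
  reset_set u v p -> p != 1%N -> (p <= n < p + c)%N ->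
  succ_ratio f n \in values c.
Proof.
move=> Rp p_neq1 /andP[le_pn lt_n].
rewrite !inE; case: (eqVneq n p) => [->|n_neq_p].
  case: p Rp p_neq1 {le_pn lt_n} => [|[//|p]] Rp _.
    by rewrite succ_ratio0 eqxx.
  by have [-> _] := reset_forgets_past Rp; case: (u _); rewrite eqxx ?orbT.
have [j En] : exists j, n = (p.+1 + j)%N by exists (n - p.+1)%N; lia.
rewrite succ_ratioE (@mem_later_values j) ?orbT //; first by lia.
by rewrite En; apply: ratios_in_states.
Qed.

(** Adding the value at [c] does not increase the count.  For [c = 2],
[f 0 = f 1] makes the letter [v 3] irrelevant, and [f 3 / f 2] is one of the two
values at a reset.  For larger [c] the list itself repeats: after a reset [p]
with [u p = false], the letter [u p.+3 = true] gives
[f p.+3 = (a + b) * f p.+1 = f p.+2], hence the value 1 again. *)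
Lemma values_not_uniq (c : nat) :
  (1 < c)%N -> ~~ uniq (succ_ratio f c :: values c).
Proof.
case: c => [|[|[|c]]] // _.
  suff : succ_ratio f 2 \in [:: reset_value false; reset_value true].
    by rewrite [uniq _]/= !inE => /orP[->|->]; rewrite ?orbT.
  have [f0 f1 f2 _] := rec_f.
  have f3 : f 3 = a * f (2 - u 3)%N + b.
    by rewrite recE; case: (v 3); rewrite ?subn1 ?subn0 /= ?f0 ?f1 mulr1.
  rewrite /succ_ratio f3 f2 !inE /reset_value.
  case: (u 3); rewrite ?subn1 ?subn0 /= ?f1 ?f2.
    by rewrite mulr1 divff ?eqxx.
  by rewrite mulrDl mulfK ?eqxx ?orbT.
have [s s_in s1] : exists2 s, s \in states 1 & s.1^-1 = reset_value false.
  exists (step (reset_state false false) (true, false)) => /=.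
    by rewrite !inE eqxx ?orbT.
  by rewrite invrK -mulrDl divff.
rewrite cons_uniq negb_and; apply/orP; right.
rewrite /values cons_uniq negb_and negbK inE -s1.
by rewrite (@mem_later_values 1) ?orbT.
Qed.

(** Away from 0, the ratios are a sliding block code of the letters: a window of
bounded length contains a reset and all letters read since then.  The shift by
[c.+1] puts that reset at [m.+2] or later, so it is neither 0 nor 1. *)
Lemma succ_ratio_window (c m n : nat) :
  (forall n, exists2 p, reset_set u v p & (p <= n < p + c)%N) ->
  (forall i, (i < c + 4)%N -> u (m + i)%N = u (n + i)%N) ->
  (forall i, (i < c + 4)%N -> v (m + i)%N = v (n + i)%N) ->
  succ_ratio f (m + c.+1)%N = succ_ratio f (n + c.+1)%N.
Proof.
move=> cover Eu Ev; have [p Rp lt_p] := cover (m + c.+1)%N.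
have [r Ep] : exists r, p = (m + r).+2 by exists (p - m - 2)%N; lia.
have {}Eu i : (i <= c - r + 1)%N ->
    u ((m + r).+2 + i)%N = u ((n + r).+2 + i)%N.
  move=> le_i; have := Eu (r.+2 + i)%N.
  by rewrite !addSn !addnS !addnA; apply; lia.
have {}Ev i : (i <= c - r + 1)%N ->
    v ((m + r).+2 + i)%N = v ((n + r).+2 + i)%N.
  move=> le_i; have := Ev (r.+2 + i)%N.
  by rewrite !addSn !addnS !addnA; apply; lia.
have [i1 i2] : (1 <= c - r + 1)%N /\ (2 <= c - r + 1)%N by lia.
have Eu0 := Eu 0%N isT; have Eu1 := Eu 1%N i1; have Eu2 := Eu 2%N i2.
have Ev0 := Ev 0%N isT; have Ev1 := Ev 1%N i1; have Ev2 := Ev 2%N i2.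
rewrite !addn0 in Eu0 Ev0; rewrite !addn1 in Eu1 Ev1; rewrite !addn2 in Eu2 Ev2.
subst p; have Rn : reset_set u v (n + r).+2.
  by move: Rp; rewrite /reset_set /= Eu0 Ev0 Eu1 Ev1 Ev2 => -[?|//]; left.
have [vm rm] := reset_forgets_past Rp; have [vn rn] := reset_forgets_past Rn.
have ratiosE j : (j <= c - r.+1)%N ->
    ratios ((m + r).+4 + j)%N = ratios ((n + r).+4 + j)%N.
  elim: j => [|j IH] lt_j; first by rewrite !addn0 rm rn Eu0 Eu2.
  have i3 : (j.+3 <= c - r + 1)%N by lia.
  have := IH (ltnW lt_j); have := Eu _ i3; have := Ev _ i3.
  rewrite !addnS !addSn => Evj Euj IHj.
  by rewrite !(ratios_step (_ + _ + _).+2) IHj Euj Evj.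
case: (eqVneq r.+1 c) => [Ec|r_neq].
  by rewrite -Ec !addnS vm vn Eu0.
rewrite !succ_ratioE; congr (_.1^-1).
have Ec l : ((l + r).+4 + (c - r.+2) = (l + c.+1).+1)%N by lia.
have := ratiosE (c - r.+2)%N; rewrite !Ec; apply.
by rewrite leq_sub2l.
Qed.

End Ratios.

(** * The gaps of the reset set *)

(** The set is infinite, so every [n] lies between two successive elements. *)
Lemma gaps_cover (c : nat) (A : set nat) : gaps_bounded_by c A ->
  forall n, exists2 p, A p & (p <= n < p + c)%N.
Proof.
move=> [s [s0 s_homo -> gap]] n.
suff [j /andP[le_j lt_j]] : exists j, (s j <= n < s j.+1)%N.
  by exists (s j); [exists j | have := gap j; lia].
elim: n => [|n [j lt_n]]; first by exists 0%N; have := s_homo 0%N 1%N isT; lia.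
have lt_s := s_homo j.+1 j.+2 (ltnSn _).
by have [?|?] := ltnP n.+1 (s j.+1); [exists j|exists j.+1]; lia.
Qed.

(** Consecutive positive integers cannot both be resets, since a reset [p] needs
[v p = false] and [v p.+1 = true]. *)
Lemma reset_gap_gt1 (c : nat) (u v : nat -> bool) :
  (forall n, exists2 p, reset_set u v p & (p <= n < p + c)%N) -> (1 < c)%N.
Proof.
case: c => [|[|//]] cover; first by have [p _] := cover 0%N; lia.
have at_reset n : reset_set u v n.
  by have [p Rp] := cover n; rewrite addn1 ltnS -eqn_leq => /eqP <-.
have [[_ [_ v2 _]]|//] := at_reset 1%N.
by have [[_ [v2' _ _]]|//] := at_reset 2%N; rewrite v2 in v2'.
Qed.

Lemma card_le_seq (T : eqType) (s : seq T) (A : set T) :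
  (forall x, A x -> x \in s) -> (A #<= `I_(size s))%card.
Proof.
case: s => [|x0 s] As.
  by rewrite (_ : A = set0) ?card_ge0 //; apply/seteqP; split=> // x /As.
apply: card_le_trans (card_image_le (nth x0 (x0 :: s)) `I_(size (x0 :: s))).
apply: subset_card_le => x /As x_in.
by exists (index x (x0 :: s)); [rewrite -index_mem in x_in | exact: nth_index].
Qed.

(** The whole theorem over an arbitrary field, once no term vanishes. *)
Lemma succ_ratio_bounded_automatic (F : fieldType) (a b : F)
    (u v : nat -> bool) (c : nat) (f : nat -> F) :
  gaps_bounded_by c (reset_set u v) ->
  satisfies_recurrence u v a b f -> (forall n, f n != 0) ->
  (range (succ_ratio f) #<= `I_(4 ^ (c - 1) + 1)%N)%card /\
  (forall k : nat, (2 <= k)%N ->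
     automatic k u -> automatic k v -> automatic k (succ_ratio f)).
Proof.
move=> /gaps_cover cover rec_f f_neq0; have c_gt1 := reset_gap_gt1 cover.
split=> [|k k_gt1 aut_u aut_v].
  have := values_not_uniq rec_f f_neq0 c_gt1.
  rewrite -ltn_size_undup [size (_ :: _)]/= -/(values a b c) => lt_size.
  apply: (@card_le_trans _ _ _
            `I_(size (undup (succ_ratio f c :: values a b c)))).
    apply: card_le_seq => _ [n _ <-]; rewrite mem_undup inE.
    have [p Rp lt_n] := cover n; case: (eqVneq p 1%N) => [Ep|p_neq1]; last first.
      by rewrite (succ_ratio_in_values rec_f f_neq0 Rp p_neq1 lt_n) orbT.
    case: (eqVneq n c) => [->|n_neq_c]; first by rewrite eqxx.
    (* 0 is then at distance less than c, except from n = c. *)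
    rewrite (@succ_ratio_in_values _ _ _ _ _ _ rec_f f_neq0 c 0%N) ?orbT //.
      by right.
    by lia.
  by rewrite card_le_II subn1 -(size_values a b c); move: lt_size; rewrite ltnS.
apply: (automatic_of_shift (N := c.+1)) => //.
have := automatic_window (c + 4) k_gt1 (automatic_pair k_gt1 aut_u aut_v).
apply: automatic_factor => // m n Ew.
have {}Ew i : (i < c + 4)%N ->
    (u (m + i)%N, v (m + i)%N) = (u (n + i)%N, v (n + i)%N).
  by move=> lt_i; have := congr1 (fun s => nth (false, false) s i) Ew;
     rewrite !nth_mkseq.
by apply: (succ_ratio_window rec_f f_neq0 cover) => i /Ew[].
Qed.

(** * Indeterminate coefficients *)

(** Evaluating both indeterminates at 1 leaves a sum of positive numbers. *)
Lemma indet_recurrence_neq0 (u v : nat -> bool) (f : nat -> ratfun2) :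
  satisfies_recurrence u v (indet ord0) (indet ord_max) f ->
  forall n, f n != 0.
Proof.
move=> [f0 f1 f2 rec_f] n.
suff [P -> P_gt0] : exists2 P : {mpoly rat[2]}, f n = tofrac P & 0 < P.@[fun=> 1].
  rewrite tofrac_eq0; apply: contraTneq P_gt0 => ->.
  by rewrite meval0 ltxx.
elim/ltn_ind: n => -[|[|[|n]]] IH.
- by exists 1; rewrite ?f0 ?tofrac1 // meval1.
- by exists 1; rewrite ?f1 ?tofrac1 // meval1.
- exists ('X_ord0 + 'X_ord_max); first by rewrite f2 tofracD.
  by rewrite mevalD !mevalXU.
have [|P EP P_gt0] := IH (n.+3 - 1 - u n.+3)%N; first by lia.
have [|Q EQ Q_gt0] := IH (n.+3 - 2 - v n.+3)%N; first by lia.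
exists ('X_ord0 * P + 'X_ord_max * Q).
  by rewrite rec_f // EP EQ tofracD !tofracM.
by rewrite mevalD !mevalM !mevalXU !mul1r addr_gt0.
Qed.

Theorem theorem4p1 (u v : nat -> bool) (c : nat) :
  (1 <= c)%N ->
  gaps_bounded_by c (reset_set u v) ->
  (forall (a b : int) (f : nat -> rat),
     satisfies_recurrence u v (a%:~R : rat) (b%:~R : rat) f ->
     (forall n, f n != 0) ->
     (range (succ_ratio f) #<= `I_(4 ^ (c - 1) + 1)%N)%card /\
     (forall k : nat, (2 <= k)%N ->
        automatic k u -> automatic k v -> automatic k (succ_ratio f))) /\
  (forall f : nat -> ratfun2,
     satisfies_recurrence u v (indet ord0) (indet ord_max) f ->
     (range (succ_ratio f) #<= `I_(4 ^ (c - 1) + 1)%N)%card /\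
     (forall k : nat, (2 <= k)%N ->
        automatic k u -> automatic k v -> automatic k (succ_ratio f))).
Proof.
move=> _ gaps; split=> [a b f rec_f f_neq0 | f rec_f].
  exact: succ_ratio_bounded_automatic gaps rec_f f_neq0.
exact: succ_ratio_bounded_automatic gaps rec_f (indet_recurrence_neq0 rec_f).
Qed.
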